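(* Let $p\ge 1$ be the number of partitions and workers and let $N\ge 1$ be the number of iterations. Let $H$ be an execution with $p$ workers over $\Pi=\{\pi_1,\dots,\pi_p\}$ in which both of the following are enforced: - Read Constraint: for all $i,j\in\{1,\dots,p\}$ and all $1\le\alpha<N$, $\;w_j[\pi_j][\alpha] < r_i[\pi_j][\alpha+1]$; - Write Constraint: for all $i,j\in\{1,\dots,p\}$ and all $1\le\alpha\le N$, $\;r_j[\pi_i][\alpha] < w_i[\pi_i][\alpha]$. Then $H$ has the same behavior as a sequential ML computation: for any initial values and any update functions, for all $i,j\in\{1,\dots,p\}$ and all $1\le\alpha\le N$, the value returned in $H$ by the read $r_i[\pi_j][\alpha]$ equals the value returned by the read of $\pi_j$ in iteration $\alpha$ of the sequential ML computation, and the value written in $H$ by $w_i[\pi_i][\alpha]$ equals the value written to $\pi_i$ in iteration $\alpha$ of the sequential ML computation, both started from the same initial values and using the same update functions.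
   Context: The parameters $\Theta=\{\theta_1,\dots,\theta_m\}$ of a machine learning model are split into pairwise disjoint partitions $\pi_1,\dots,\pi_p$ whose union is the whole parameter set. There is a bijection between workers and partitions; worker $i$ is responsible for updating $\pi_i$. Operations: in iteration $\alpha\in\{1,\dots,N\}$, worker $i$ performs the reads $r_i[\pi_j][\alpha]$ for $j=1,\dots,p$ (worker $i$ reads partition $\pi_j$ in iteration $\alpha$) and the single write $w_i[\pi_i][\alpha]$ (worker $i$ writes partition $\pi_i$ in iteration $\alpha$). Execution: a sequence (strict total order $<$, the ''happens-before'' relation) in which each of the operations $r_i[\pi_j][\alpha]$, $w_i[\pi_i][\alpha]$ ($1\le i,j\le p$, $1\le\alpha\le N$) occurs exactly once, and such that $r_i[\pi_j][\alpha]<w_i[\pi_i][\alpha]$ for all $i,j,\alpha$. No other ordering between operations is assumed. Value semantics: let $V_j$ be the set of possible values of partition $\pi_j$. Each $\pi_j$ has an initial value $v_j^{(0)}\in V_j$. A read of $\pi_j$ returns the value written by the most recent preceding write to $\pi_j$, or $v_j^{(0)}$ if there is none. The underlying fixed-point iteration is given by update functions $f_i:V_1\times\cdots\times V_p\to V_i$ (the data set is immutable and absorbed into $f_i$): the write $w_i[\pi_i][\alpha]$ writes $f_i(x_1,\dots,x_p)$, where $x_j$ is the value returned by $r_i[\pi_j][\alpha]$. Sequential ML computation: a single thread performs iterations $\alpha=1,\dots,N$ one after another; in iteration $\alpha$ it first reads all of $\pi_1,\dots,\pi_p$, obtaining $(x_1,\dots,x_p)$, and then writes $f_i(x_1,\dots,x_p)$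 to $\pi_i$ for every $i=1,\dots,p$; each iteration is completed before the next one starts. *)

(* Defs.v *)
From HB Require Import structures.
From mathcomp Require Import all_boot.
From Stdlib Require Import FunctionalExtensionality.

Set Implicit Arguments.
Unset Strict Implicit.
Unset Printing Implicit Defensive.

(* Workers and partitions are both indexed by 'I_p (worker i owns partition i).
   Iterations are indexed by 'I_N, so a : 'I_N is the iteration numbered a + 1
   in 1-based counting.
   Read i j a : worker i reads partition j in iteration a.
   Write i a  : worker i writes its own partition i in iteration a. *)
Inductive op (p N : nat) : Type :=
  | Read of 'I_p & 'I_p & 'I_N
  | Write of 'I_p & 'I_N.

Section OpEqType.
Variables p N : nat.

Definition op_to_sum (o : op p N) : ('I_p * 'I_p * 'I_N) + ('I_p * 'I_N) :=
  match o with Read i j a => inl (i, j, a) | Write i a => inr (i, a) end.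

Definition op_of_sum (s : ('I_p * 'I_p * 'I_N) + ('I_p * 'I_N)) : op p N :=
  match s with inl (i, j, a) => Read i j a | inr (i, a) => Write i a end.

Lemma op_to_sumK : cancel op_to_sum op_of_sum.
Proof. by case. Qed.

HB.instance Definition _ := Equality.copy (op p N) (can_type op_to_sumK).

End OpEqType.

Section Execution.
Variables p N : nat.
Implicit Types (H : seq (op p N)) (x y : op p N).

(* Intended for sequences in which x and y both occur, exactly once. *)
Definition before H x y : bool := index x H < index y H.

Record is_execution H : Prop := IsExecution {
  exec_once : forall x, count_mem x H = 1;
  exec_read_write : forall (i j : 'I_p) (a : 'I_N),
    before H (Read i j a) (Write i a)
}.

Definition read_constraint H : Prop :=
  forall (i j : 'I_p) (a b : 'I_N), b = a.+1 :> nat ->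
    before H (Write j a) (Read i j b).

Definition write_constraint H : Prop :=
  forall (i j : 'I_p) (a : 'I_N), before H (Read j i a) (Write i a).

(* Write j b is the most recent write to partition j preceding x. *)
Definition last_write H (j : 'I_p) (b : 'I_N) x : Prop :=
  before H (Write j b) x /\
  forall c : 'I_N, before H (Write j c) x ->
    ~~ before H (Write j b) (Write j c).

End Execution.

Section Values.
Variables (p N : nat) (V : 'I_p -> Type).
Variable f : forall i : 'I_p, (forall j : 'I_p, V j) -> V i.
Variable v0 : forall j : 'I_p, V j.

(* rd i j a is the value returned by Read i j a, and wr i a is the value
   written by Write i a, when H is run from the initial values v0 with update
   functions f.  For every execution such rd and wr exist and are unique:
   see values_exist and values_unique. *)
Record values_in (H : seq (op p N))
    (rd : forall i j : 'I_p, 'I_N -> V j)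
    (wr : forall i : 'I_p, 'I_N -> V i) : Prop := ValuesIn {
  read_last_write : forall (i j : 'I_p) (a b : 'I_N),
    last_write H j b (Read i j a) -> rd i j a = wr j b;
  read_initial : forall (i j : 'I_p) (a : 'I_N),
    (forall b : 'I_N, ~~ before H (Write j b) (Read i j a)) ->
    rd i j a = v0 j;
  write_update : forall (i : 'I_p) (a : 'I_N),
    wr i a = f i (fun j => rd i j a)
}.

(* One iteration of the sequential computation on memory m: all partitions are
   read first (their values are m), then the partitions are overwritten one
   after another. *)
Definition seq_iteration (m : forall j, V j) : forall j, V j :=
  foldl (fun m' i => dfwith m' (f i m)) m (enum 'I_p).

(* The memory after n completed sequential iterations. *)
Definition seq_memory (n : nat) : forall j, V j := iter n seq_iteration v0.

(* Exactly a iterations precede the one indexed by a : 'I_N. *)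
Definition seq_read (j : 'I_p) (a : 'I_N) : V j := seq_memory a j.

Definition seq_write (i : 'I_p) (a : 'I_N) : V i :=
  f i (fun j => seq_read j a).

End Values.

Section WellDefined.
Variables (p N : nat) (V : 'I_p -> Type).
Variable f : forall i : 'I_p, (forall j : 'I_p, V j) -> V i.
Variable v0 : forall j : 'I_p, V j.
Variable H : seq (op p N).
Hypothesis execH : is_execution H.

Lemma exec_mem x : x \in H.
Proof. by rewrite -has_pred1 has_count (exec_once execH). Qed.

Lemma last_write_unique j b c x :
  last_write H j b x -> last_write H j c x -> b = c.
Proof.
move=> [bx bmax] [cx cmax].
have := bmax c cx; have := cmax b bx; rewrite /before -!leqNgt => le1 le2.
have eqi : index (Write j b) H = index (Write j c) H.
  by apply/eqP; rewrite eqn_leq le1 le2.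
have := congr1 (nth (Write j b) H) eqi.
by rewrite !nth_index ?exec_mem // => -[].
Qed.

Lemma last_write_cases j x :
  (exists b, last_write H j b x) \/ (forall b, ~~ before H (Write j b) x).
Proof.
case: (pickP (fun b => before H (Write j b) x)) => [b0 b0x|none]; last first.
  by right=> b; rewrite none.
left.
have [b bx bmax] :=
  @arg_maxnP _ b0 (fun b => before H (Write j b) x)
    (fun b => index (Write j b) H) b0x.
by exists b; split=> // c cx; rewrite /before -leqNgt; apply: bmax.
Qed.

Definition lastb (j : 'I_p) x : option 'I_N :=
  [pick b | before H (Write j b) x &&
     [forall c, before H (Write j c) x ==>
        ~~ before H (Write j b) (Write j c)]].

Lemma lastbP j x b : reflect (last_write H j b x) (lastb j x == Some b).
Proof.
have toP c : before H (Write j c) x && [forall d, before H (Write j d) x ==>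
    ~~ before H (Write j c) (Write j d)] -> last_write H j c x.
  by case/andP=> cx /forallP h; split=> // d; apply/implyP.
apply: (iffP eqP); rewrite /lastb; case: pickP => [c /toP hc|none] //.
- by case=> <-.
- by move=> hb; rewrite (last_write_unique hc hb).
- case=> bx bmax; have := none b; rewrite bx /=.
  by move/forallP; case=> c; apply/implyP/bmax.
Qed.

Fixpoint read_fuel (n : nat) (i j : 'I_p) (a : 'I_N) : V j :=
  if n isn't n'.+1 then v0 j else
  if lastb j (Read i j a) is Some b then f j (fun k => read_fuel n' j k b)
  else v0 j.

Lemma read_fuel_stable m n i j a :
  index (Read i j a) H < m -> index (Read i j a) H < n ->
  read_fuel m i j a = read_fuel n i j a.
Proof.
elim: m n i j a => [|m IH] [|n] i j a //= im jn.
case E: lastb => [b|] //; move/eqP/lastbP: E => [bx _].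
congr (f _ _); apply: functional_extensionality_dep => k.
have lt : index (Read j k b) H < index (Read i j a) H.
  exact: ltn_trans (exec_read_write execH j k b) bx.
by apply: IH; apply: leq_trans lt _.
Qed.

Lemma values_exist : exists rd wr, values_in f v0 H rd wr.
Proof.
pose rd := read_fuel (size H).+1.
exists rd, (fun i a => f i (fun j => rd i j a)); split=> //.
- move=> i j a b lw; rewrite {1}/rd /=.
  move/lastbP/eqP: (lw) => ->.
  congr (f _ _); apply: functional_extensionality_dep => k.
  by apply: read_fuel_stable; rewrite ?ltnS ?index_size // index_mem exec_mem.
- move=> i j a none; rewrite /rd /=.
  by case E: lastb => [b|] //; move/eqP/lastbP: E => [bx _]; have := none b; rewrite bx.
Qed.

Lemma values_unique rd wr rd' wr' :
  values_in f v0 H rd wr -> values_in f v0 H rd' wr' ->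
  (forall i j a, rd i j a = rd' i j a) /\ (forall i a, wr i a = wr' i a).
Proof.
move=> val val'.
have eqrd n : forall i j a, index (Read i j a) H < n -> rd i j a = rd' i j a.
  elim: n => // n IH i j a; rewrite ltnS => lt_n.
  case: (last_write_cases j (Read i j a)) => [[b lw]|none]; last first.
    by rewrite (read_initial val none) (read_initial val' none).
  rewrite (read_last_write val lw) (read_last_write val' lw).
  rewrite (write_update val) (write_update val').
  congr (f _ _); apply: functional_extensionality_dep => k; apply: IH.
  by apply: leq_trans lt_n; apply: ltn_trans (exec_read_write execH _ _ _) lw.1.
have eqr i j a : rd i j a = rd' i j a by apply: (eqrd _ _ _ _ (ltnSn _)).
split=> // i a; rewrite (write_update val) (write_update val').
by congr (f _ _); apply: functional_extensionality_dep => k.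
Qed.

End WellDefined.

(* Main.v *)
(* The two constraints and the read-before-write order interleave the writes
   to a partition with its reads: every read of pi_j in iteration a falls after
   the write of pi_j in iteration a - 1 and before the one in iteration a.  So
   it returns the value written in iteration a - 1 (the initial value if a is
   the first iteration), and induction on a gives the sequential values. *)
Require Import Defs.
From mathcomp Require Import all_boot.
From Stdlib Require Import FunctionalExtensionality.

(** Every update is computed from the snapshot [m], never from the partly overwritten memory, so the
    order of the overwrites does not matter. *)
Lemma seq_iterationE (p : nat) (V : 'I_p -> Type)
    (f : forall i : 'I_p, (forall j : 'I_p, V j) -> V i)
    (m : forall j : 'I_p, V j) (j : 'I_p) :
  seq_iteration f m j = f j m.
Proof.
have foldE (s : seq 'I_p) (m' : forall k : 'I_p, V k) :
    foldl (fun m' i => dfwith m' (f i m)) m' s j =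
    if j \in s then f j m else m' j.
  elim: s m' => //= i s IH m'; rewrite IH inE.
  case: ifP => _; first by rewrite orbT.
  by rewrite orbF; case: eqVneq => [->|ne]; rewrite ?dfwith_in // dfwith_out // eq_sym.
by rewrite /seq_iteration foldE mem_enum.
Qed.

Section ConstrainedExecution.
Variables (p N : nat) (H : seq (op p N)).
Hypotheses (execH : is_execution H) (readC : read_constraint H).

(** Worker [j]'s read of its own partition in the next iteration separates two consecutive writes to
    that partition. *)
Lemma index_write_homo (j : 'I_p) (a b : 'I_N) :
  a <= b -> index (Write j a) H <= index (Write j b) H.
Proof.
case: b => n; elim: n => [|n IH] ltN /=; rewrite leq_eqVlt => /orP[/eqP eq_ab|//].
- by have -> : a = Ordinal ltN by exact: val_inj.
- by have -> : a = Ordinal ltN by exact: val_inj.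
move=> lt_an; apply: leq_trans (IH (ltnW ltN) lt_an) _.
have rd := readC j j (Ordinal (ltnW ltN)) (Ordinal ltN) erefl.
exact: ltnW (ltn_trans rd (exec_read_write execH j j _)).
Qed.

Hypothesis writeC : write_constraint H.

Lemma before_write_read (i j : 'I_p) (a b : 'I_N) :
  before H (Write j b) (Read i j a) = (b < a).
Proof.
apply/idP/idP => [wb|lt_ba].
  rewrite ltnNge; apply/negP => le_ab.
  have := leq_trans (writeC j i a) (index_write_homo j _ _ le_ab).
  by move/(ltn_trans wb); rewrite ltnn.
(* The read constraint only speaks of consecutive iterations, so write [b] is first compared with
   write [a.-1]; [b < a] makes [a] positive. *)
have ltN : a.-1 < N by apply: leq_ltn_trans (leq_pred a) (ltn_ord a).
have a_gt0 : 0 < a by apply: leq_ltn_trans lt_ba.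
apply: leq_ltn_trans (readC i j (Ordinal ltN) a _); last by rewrite /= prednK.
by apply: index_write_homo; rewrite /= -ltnS prednK.
Qed.

Lemma last_write_read (i j : 'I_p) (a b : 'I_N) :
  a = b.+1 :> nat -> last_write H j b (Read i j a).
Proof.
move=> eq_a; split=> [|c]; rewrite before_write_read eq_a // ltnS => le_cb.
by rewrite /before -leqNgt index_write_homo.
Qed.

End ConstrainedExecution.

Theorem theorem2 (p N : nat) (hp : 1 <= p) (hN : 1 <= N)
    (H : seq (op p N)) (execH : is_execution H)
    (readC : read_constraint H) (writeC : write_constraint H) :
  forall (V : 'I_p -> Type)
    (v0 : forall j : 'I_p, V j)
    (f : forall i : 'I_p, (forall j : 'I_p, V j) -> V i)
    (rd : forall i j : 'I_p, 'I_N -> V j)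
    (wr : forall i : 'I_p, 'I_N -> V i),
  values_in f v0 H rd wr ->
  (forall (i j : 'I_p) (a : 'I_N), rd i j a = seq_read f v0 j a) /\
  (forall (i : 'I_p) (a : 'I_N), wr i a = seq_write f v0 i a).
Proof.
move=> V v0 f rd wr val.
have rdE (i j : 'I_p) (a : 'I_N) : rd i j a = seq_read f v0 j a.
  (* The induction keeps [i] and [j] general: a value read by worker [i] was computed by worker [j]
     from its own reads of all partitions. *)
  case: a => n; elim: n i j => [|n IH] i j ltN.
    rewrite (read_initial val) // => b.
    by rewrite (before_write_read _ _ _ execH readC writeC).
  have lw := last_write_read _ _ _ execH readC writeC i j
    (Ordinal ltN) (Ordinal (ltnW ltN)) erefl.
  rewrite (read_last_write val lw) (write_update val).
  rewrite /seq_read /seq_memory /= seq_iterationE.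
  by congr (f _ _); apply: functional_extensionality_dep => k; apply: IH.
split=> // i a; rewrite (write_update val) /seq_write.
by congr (f _ _); apply: functional_extensionality_dep => k.
Qed.
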